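(* Consider the minimization problems $(X,Y,\Phi,u)$, $(X,Y,\bar\Phi,\bar u)$ and $(X,Y,\hat\Phi,\hat u)$. Then the value functions coincide, $u^*=\bar u^*=\hat u^*$, and for each $x\in\mathrm{Dom}(\Phi)$ the following statements hold: (i) If one of $u,\bar u,\hat u$ is feasible path transfer upper semicontinuous at $x$ (that is, on $\mathrm{Gr}_{\{x\}}(\Phi)$, $\mathrm{Gr}_{\{x\}}(\bar\Phi)$, $\mathrm{Gr}_{\{x\}}(\hat\Phi)$ respectively), so are the other two. (ii) If one of $u,\bar u,\hat u$ is lower inf-semicontinuous at $x$, so are the other two. (iii) $u$ is lower min-semicontinuous at $x$ if and only if $\bar u$ is lower min-semicontinuous at $x$. (iv) When $\hat\Phi(x)\neq\emptyset$, if one of $u,\bar u,\hat u$ is lower min-semicontinuous at $x$, so are the other two.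
   Context: $X,Y$ are topological spaces, $\Phi:X\to 2^Y$ is a multifunction ($\Phi(x)\subset Y$, possibly empty), $\mathrm{Dom}(\Phi)=\{x\in X:\Phi(x)\ne\emptyset\}$, $\mathrm{Gr}_E(\Phi)=\{(x,y)\in E\times Y:y\in\Phi(x)\}$, $\mathrm{Gr}(\Phi)=\mathrm{Gr}_X(\Phi)$, $u:\mathrm{Gr}(\Phi)\to\overline{\mathbb{R}}=\mathbb{R}\cup\{\pm\infty\}$. Define $\bar\Phi(x)=Y$ for all $x\in X$ and $\bar u:X\times Y\to\overline{\mathbb{R}}$ by $\bar u(x,y)=u(x,y)$ if $y\in\Phi(x)$ and $\bar u(x,y)=+\infty$ otherwise. Define $\hat\Phi(x)=\{y\in Y:\bar u(x,y)<+\infty\}$ and $\hat u:\mathrm{Gr}(\hat\Phi)\to\overline{\mathbb{R}}$, $\hat u(x,y)=\bar u(x,y)$. For a problem $(X,Y,\Psi,v)$, with $\Psi:X\to2^Y$ and $v:\mathrm{Gr}(\Psi)\to\overline{\mathbb{R}}$, the value function is $v^*(x)=\inf_{y\in\Psi(x)}v(x,y)$ for $x\in X$, with $\inf\emptyset=+\infty$. A neighborhood of $x$ is an open subset of $X$ containing $x$. The definitions below are applied verbatim to each of the three problems (also at points $x$ where $\Psi(x)$ may be empty). - $v$ is feasible path transfer upper semicontinuous on $\mathrm{Gr}_{\{x\}}(\Psi)$ if for each $y\in\Psi(x)$ and $\gamma\in\mathbb{R}$ with $v(x,y)<\gamma$ there is a neighborhood $U$ of $x$ such that for each $x'\in U$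 there exists $y'\in\Psi(x')$ with $v(x',y')<\gamma$. - $v$ is lower inf-semicontinuous at $x$ if for all $\gamma\in\mathbb{R}$ such that $v(x,y)>\gamma$ for each $y\in\Psi(x)$, there exists a neighborhood $U$ of $x$ such that $v(x',y')>\gamma$ for each $x'\in U$ and $y'\in\Psi(x')$. - $v$ is lower min-semicontinuous at $x$ if there exists $y^*\in\Psi(x)$ such that for every $\gamma\in\mathbb{R}$ with $v(x,y^* )>\gamma$ there exists a neighborhood $U$ of $x$ such that $v(x',y')>\gamma$ for each $x'\in U$ and $y'\in\Psi(x')$. *)

(* Defs.v *)
From HB Require Import structures.
From mathcomp Require Import all_boot all_order all_algebra.
From mathcomp Require Import all_classical all_reals all_analysis.

Set Implicit Arguments.
Unset Strict Implicit.
Unset Printing Implicit Defensive.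

Import Order.TTheory GRing.Theory Num.Theory.

Local Open Scope classical_set_scope.
Local Open Scope ereal_scope.

(* A multifunction from X to Y is a map X -> set Y; its values may be empty.
   An objective function is defined on the graph only: its domain is the graph
   seen as a type, so it carries no values outside the graph. *)

Definition dom (X Y : Type) (Psi : X -> set Y) : set X :=
  [set x | Psi x !=set0].

Definition graph (X Y : Type) (Psi : X -> set Y) : set (X * Y) :=
  [set p | Psi p.1 p.2].

Definition graph_pt (X Y : Type) (Psi : X -> set Y) (x : X) (y : Y)
    (hy : Psi x y) : graph Psi :=
  exist _ (x, y) (mem_set (hy : graph Psi (x, y))).

Section Problem.
Variables (R : realType) (X Y : topologicalType).
Variables (Psi : X -> set Y) (v : graph Psi -> \bar R).

(* By the library's convention, ereal_inf set0 = +oo. *)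
Definition value_function (x : X) : \bar R :=
  ereal_inf [set a | exists (y : Y) (hy : Psi x y), a = v (graph_pt hy)].

(* Upper semicontinuity on the part of the graph lying over {x}. *)
Definition feasible_path_transfer_usc (x : X) : Prop :=
  forall (y : Y) (hy : Psi x y) (gamma : R), v (graph_pt hy) < gamma%:E ->
  exists U : set X, [/\ open U, U x &
    forall x', U x' ->
      exists (y' : Y) (hy' : Psi x' y'), v (graph_pt hy') < gamma%:E].

Definition lower_inf_semicontinuous (x : X) : Prop :=
  forall gamma : R,
  (forall (y : Y) (hy : Psi x y), v (graph_pt hy) > gamma%:E) ->
  exists U : set X, [/\ open U, U x &
    forall x', U x' ->
      forall (y' : Y) (hy' : Psi x' y'), v (graph_pt hy') > gamma%:E].

Definition lower_min_semicontinuous (x : X) : Prop :=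
  exists (ystar : Y) (hystar : Psi x ystar),
  forall gamma : R, v (graph_pt hystar) > gamma%:E ->
  exists U : set X, [/\ open U, U x &
    forall x', U x' ->
      forall (y' : Y) (hy' : Psi x' y'), v (graph_pt hy') > gamma%:E].

End Problem.

Definition Phi_bar (X Y : Type) (x : X) : set Y := setT.

Section Extensions.
Variables (R : realType) (X Y : topologicalType).
Variables (Phi : X -> set Y) (u : graph Phi -> \bar R).

Definition u_ext (x : X) (y : Y) : \bar R :=
  match pselect (Phi x y) with
  | left hy => u (graph_pt hy)
  | right _ => +oo
  end.

(* u_ext, with X * Y viewed as the graph of the full multifunction. *)
Definition u_bar (p : graph (@Phi_bar X Y)) : \bar R :=
  u_ext (val p).1 (val p).2.

Definition Phi_hat (x : X) : set Y := [set y | u_ext x y < +oo].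

Definition u_hat (p : graph Phi_hat) : \bar R := u_ext (val p).1 (val p).2.

End Extensions.

Arguments u_hat {R X Y Phi} u p.

(* Main.v *)
Require Import Defs.
From HB Require Import structures.
From mathcomp Require Import all_boot all_order all_algebra.
From mathcomp Require Import all_classical all_reals all_analysis.

Set Implicit Arguments.
Unset Strict Implicit.
Unset Printing Implicit Defensive.

Import Order.TTheory GRing.Theory Num.Theory.

Local Open Scope classical_set_scope.

(** A point whose value is [+oo] does not influence a minimization problem: it
    never lowers the infimum, never satisfies a strict upper bound [v < gamma],
    and always satisfies a strict lower bound [v > gamma] with [gamma] real.

    The three problems are therefore handled at once.  Each of [u], [u_bar u]
    and [u_hat u] is the restriction to its graph of the same function
    [u_ext u] on the whole of [X * Y], which is [+oo] off that graph
    ([extends_by_pinfty]).  For any problem [(Psi, v)] with such an extension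
    [w], the value function and each of the three continuity properties can be
    expressed by [w] alone, with quantifiers over all of [Y]
    ([value_functionE], [feasible_path_transfer_uscE],
    [lower_inf_semicontinuousE], [lower_min_semicontinuousE]); hence they
    agree for problems sharing an extension.

    Only lower min-semicontinuity asks for a feasible witness, and this is why
    nonemptiness of [Psi x] enters: a witness [ystar] off the graph has
    [w x ystar = +oo], so the values of [w] near [x] exceed every real number,
    and any point of [Psi x] can replace it. *)

Section ExtensionByInfinity.
Local Open Scope ereal_scope.
Variables (R : realType) (X Y : topologicalType).

Definition extends_by_pinfty (Psi : X -> set Y) (v : graph Psi -> \bar R)
    (w : X -> Y -> \bar R) : Prop :=
  (forall x y (hy : Psi x y), v (graph_pt hy) = w x y) /\
  (forall x y, ~ Psi x y -> w x y = +oo).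

Definition locally_above (w : X -> Y -> \bar R) (x : X) (gamma : R) : Prop :=
  exists U : set X, [/\ open U, U x &
    forall x', U x' -> forall y', gamma%:E < w x' y'].

Section Characterizations.
Variables (Psi : X -> set Y) (v : graph Psi -> \bar R) (w : X -> Y -> \bar R).
Hypothesis vw : extends_by_pinfty v w.

Lemma graph_gt_extension (x : X) (gamma : R) :
  (forall y (hy : Psi x y), gamma%:E < v (graph_pt hy)) <->
  (forall y, gamma%:E < w x y).
Proof.
have [vE wE] := vw; split=> [vgt y|wgt y hy]; last by rewrite vE.
have [hy|nhy] := pselect (Psi x y); first by rewrite -(vE _ _ hy).
by rewrite wE// ltry.
Qed.

Lemma graph_lt_extension (x : X) (gamma : R) :
  (exists y (hy : Psi x y), v (graph_pt hy) < gamma%:E) <->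
  (exists y, w x y < gamma%:E).
Proof.
have [vE wE] := vw; split=> [[y [hy]]|[y wlt]].
  by rewrite vE; exists y.
have [hy|nhy] := pselect (Psi x y); first by exists y, hy; rewrite vE.
by move: wlt; rewrite wE.
Qed.

Lemma graph_locally_above (x : X) (gamma : R) :
  (exists U : set X, [/\ open U, U x & forall x', U x' ->
    forall y' (hy' : Psi x' y'), gamma%:E < v (graph_pt hy')]) <->
  locally_above w x gamma.
Proof.
by split=> -[U [oU Ux Ugt]]; exists U; split=> // x' /Ugt/graph_gt_extension.
Qed.

Lemma value_functionE (x : X) : value_function v x = ereal_inf (range (w x)).
Proof.
have [vE wE] := vw; apply/le_anti/andP; split.
- apply/ereal_infP => _ [y _ <-].
  have [hy|nhy] := pselect (Psi x y); last by rewrite wE// leey.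
  by apply: ereal_inf_lbound; exists y, hy; rewrite vE.
- apply/ereal_infP => _ [y [hy ->]].
  by rewrite vE; apply: ereal_inf_lbound; exists y.
Qed.

Lemma feasible_path_transfer_uscE (x : X) :
  feasible_path_transfer_usc v x <->
  forall gamma : R, (exists y, w x y < gamma%:E) ->
  exists U : set X, [/\ open U, U x &
    forall x', U x' -> exists y', w x' y' < gamma%:E].
Proof.
split=> [vusc gamma /graph_lt_extension[y [hy vlt]]|wusc y hy gamma vlt].
- have [U [oU Ux Ult]] := vusc _ _ _ vlt.
  by exists U; split=> // x' /Ult/graph_lt_extension.
- have /wusc[U [oU Ux Ult]] : exists y, w x y < gamma%:E.
    by apply/graph_lt_extension; exists y, hy.
  by exists U; split=> // x' /Ult/graph_lt_extension.
Qed.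

Lemma lower_inf_semicontinuousE (x : X) :
  lower_inf_semicontinuous v x <->
  forall gamma : R, (forall y, gamma%:E < w x y) -> locally_above w x gamma.
Proof.
by split=> lsc gamma /graph_gt_extension/lsc/graph_locally_above.
Qed.

(** The hypothesis [Psi x !=set0] is essential: without it the left-hand side
    fails, while over a nonempty [Y] the right-hand side holds whenever [w] is
    identically [+oo] on a neighborhood of [x]. *)
Lemma lower_min_semicontinuousE (x : X) : Psi x !=set0 ->
  lower_min_semicontinuous v x <->
  exists y, forall gamma : R, gamma%:E < w x y -> locally_above w x gamma.
Proof.
have [vE wE] := vw; move=> [y0 hy0]; split=> [[y [hy vlsc]]|[y wlsc]].
  by exists y => gamma; rewrite -(vE _ _ hy) => /vlsc/graph_locally_above.
have [hy|nhy] := pselect (Psi x y).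
  by exists y, hy => gamma; rewrite vE => /wlsc/graph_locally_above.
(* Here w x y = +oo, so wlsc applies to every real gamma. *)
exists y0, hy0 => gamma _; apply/graph_locally_above/wlsc.
by rewrite wE// ltry.
Qed.

End Characterizations.

Section CommonExtension.
Variables (Phi : X -> set Y) (u : graph Phi -> \bar R).

Lemma u_extends_by_pinfty : extends_by_pinfty u (u_ext u).
Proof.
split=> x y hy; rewrite /u_ext; case: pselect => // hy'.
by rewrite (Prop_irrelevance hy hy').
Qed.

Lemma u_bar_extends_by_pinfty : extends_by_pinfty (u_bar u) (u_ext u).
Proof. by split=> // x y /(_ I). Qed.

Lemma u_hat_extends_by_pinfty : extends_by_pinfty (u_hat u) (u_ext u).
Proof.
by split=> // x y /negP; rewrite -leNgt leye_eq => /eqP.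
Qed.

End CommonExtension.

End ExtensionByInfinity.

Theorem theorem10 (R : realType) (X Y : topologicalType)
    (Phi : X -> set Y) (u : graph Phi -> \bar R) :
  (value_function u = value_function (u_bar u) /\
   value_function (u_bar u) = value_function (u_hat u)) /\
  forall x : X, dom Phi x ->
  [/\ [<-> feasible_path_transfer_usc u x;
           feasible_path_transfer_usc (u_bar u) x;
           feasible_path_transfer_usc (u_hat u) x],
      [<-> lower_inf_semicontinuous u x;
           lower_inf_semicontinuous (u_bar u) x;
           lower_inf_semicontinuous (u_hat u) x],
      (lower_min_semicontinuous u x <-> lower_min_semicontinuous (u_bar u) x) &
      Phi_hat u x !=set0 ->
      [<-> lower_min_semicontinuous u x;
           lower_min_semicontinuous (u_bar u) x;
           lower_min_semicontinuous (u_hat u) x]].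
Proof.
have eu := u_extends_by_pinfty u.
have eb := u_bar_extends_by_pinfty u.
have eh := u_hat_extends_by_pinfty u.
split.
  by split; apply/funext => x; rewrite !(value_functionE eu, value_functionE eb,
    value_functionE eh).
move=> x x_dom.
have fu := feasible_path_transfer_uscE eu x.
have fb := feasible_path_transfer_uscE eb x.
have fh := feasible_path_transfer_uscE eh x.
have iu := lower_inf_semicontinuousE eu x.
have ib := lower_inf_semicontinuousE eb x.
have ih := lower_inf_semicontinuousE eh x.
have bar_neq0 : @Phi_bar X Y x !=set0 by have [y _] := x_dom; exists y.
have mu := lower_min_semicontinuousE eu x_dom.
have mb := lower_min_semicontinuousE eb bar_neq0.
split.
- by tfae; [move/fu/fb | move/fb/fh | move/fh/fu].
- by tfae; [move/iu/ib | move/ib/ih | move/ih/iu].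
- by split; [move/mu/mb | move/mb/mu].
- move=> /(lower_min_semicontinuousE eh) mh.
  by tfae; [move/mu/mb | move/mb/mh | move/mh/mu].
Qed.
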